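(* There is an online algorithm whose competitive ratio is at most $211$ for the submodular matroid secretary problem on laminar matroids. That is, there is an online algorithm such that for every laminar matroid $(U,\mathcal{I})$ and every non-negative, monotonically non-decreasing submodular function $f:2^U\to\mathbb{R}_{\ge 0}$, the accepted set $\mathrm{ALG}$ is always independent and satisfies $\mathbb{E}[f(\mathrm{ALG})]\ge \frac{1}{211}\max_{T\in\mathcal{I}} f(T)$.
   Context: Submodular matroid secretary problem: $U$ is a finite ground set and $(U,\mathcal{I})$ is a matroid known to the algorithm. An adversary fixes a non-negative, monotonically non-decreasing submodular function $f:2^U\to\mathbb{R}_{\ge 0}$ (submodular: $f(S)+f(T)\ge f(S\cup T)+f(S\cap T)$ for all $S,T\subseteq U$). The elements of $U$ then arrive one at a time in a uniformly random order. The algorithm may query $f(T)$ only for sets $T$ of elements that have already arrived. When an element arrives, the algorithm must immediately and irrevocably decide whether to accept it, and the set $\mathrm{ALG}$ of accepted elements must always be in $\mathcal{I}$. The algorithm is $C$-competitive (has competitive ratio at most $C$) if for every $f$, $\mathbb{E}[f(\mathrm{ALG})]\ge \frac{1}{C}\max_{T\in\mathcal{I}}f(T)$, where the expectation is over the random arrival order and the algorithm's internal randomness. Laminar matroid: a family $\mathcal{F}=\{B_1,\dots,B_\ell\}$ of subsets of $U$ is laminar if for any two members either they are disjoint or one contains the other. Each $B_i$ has a capacity $\mu(B_i)$ (a non-negative integer). The laminar matroid has independent sets $\mathcal{I}=\{T\subseteq U: |T\cap B_i|\le \mu(B_i)\ \forall i\}$. *)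

(* Defs.v *)
From HB Require Import structures.
From mathcomp Require Import all_boot all_order all_algebra fingroup perm.
From Stdlib Require Rdefinitions.
Notation R := Rdefinitions.R.
From mathcomp Require Import Rstruct.
Set Implicit Arguments. Unset Strict Implicit. Unset Printing Implicit Defensive.
Import Order.TTheory GRing.Theory Num.Theory.
Local Open Scope ring_scope.

Definition nonneg_fun (U : finType) (f : {set U} -> R) : Prop :=
  forall S : {set U}, 0 <= f S.

Definition monotone_fun (U : finType) (f : {set U} -> R) : Prop :=
  forall S T : {set U}, S \subset T -> f S <= f T.

Definition submodular (U : finType) (f : {set U} -> R) : Prop :=
  forall S T : {set U}, f (S :|: T) + f (S :&: T) <= f S + f T.

Definition laminar (U : finType) (F : {set {set U}}) : Prop :=
  forall A B : {set U}, A \in F -> B \in F ->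
    [disjoint A & B] \/ A \subset B \/ B \subset A.

Definition lam_indep (U : finType) (F : {set {set U}}) (mu : {set U} -> nat)
  (T : {set U}) : Prop :=
  forall B : {set U}, B \in F -> (#|T :&: B| <= mu B)%N.

(* A deterministic online strategy: given the sequence of elements arrived so
   far (the last one being the current element) and the value oracle, decide
   whether to accept the current element. *)
Definition strategy (U : finType) := seq U -> ({set U} -> R) -> bool.

Definition online (U : finType) (d : strategy U) : Prop :=
  forall (s : seq U) (g g' : {set U} -> R),
    (forall T : {set U}, T \subset [set x in s] -> g T = g' T) ->
    d s g = d s g'.

Fixpoint accepted_rec (U : finType) (d : strategy U) (f : {set U} -> R)
  (pre rest : seq U) : seq U :=
  match rest with
  | [::] => [::]
  | x :: r =>
      let pre' := rcons pre x in
      (if d pre' f then [:: x] else [::]) ++ accepted_rec d f pre' r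
  end.

Definition ALG (U : finType) (d : strategy U) (f : {set U} -> R) (s : seq U)
  : {set U} := [set x in accepted_rec d f [::] s].

(* Arrival order induced by a permutation of U (uniformly random permutation
   = uniformly random arrival order). *)
Definition arrival (U : finType) (p : {perm U}) : seq U := map p (enum U).

(* A randomized online algorithm for laminar matroids: given the (known)
   matroid, a finitely supported probability distribution over deterministic
   online strategies, as a list of (probability, strategy) pairs. *)
Definition rand_alg :=
  forall (U : finType) (F : {set {set U}}) (mu : {set U} -> nat),
    seq (R * strategy U).

Definition valid_distr (U : finType) (D : seq (R * strategy U)) : Prop :=
  (forall p, List.In p D -> 0 <= p.1 /\ online p.2) /\
  \sum_(p <- D) p.1 = 1.

Definition expected_value (U : finType) (D : seq (R * strategy U))
  (f : {set U} -> R) : R :=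
  \sum_(p <- D) p.1 *
    ((#|U|`!)%:R^-1 * \sum_(q : {perm U}) f (ALG p.2 f (arrival q))).

(* Main.v *)
Require Import Defs.
From HB Require Import structures.
From mathcomp Require Import all_boot all_order all_algebra fingroup perm.
From mathcomp Require Import Rstruct.
From mathcomp Require Import ring lra.
From Stdlib Require List.
Import Order.TTheory GRing.Theory Num.Theory.
Local Open Scope ring_scope.

(**
Every element independently joins a sample S with probability 39/40; this is
realised by rejecting a binomially distributed number of first arrivals. The
greedy algorithm is run on all elements at once, with M the current solution:
the feasible element u of largest marginal value over M is examined, and joins
M if it is in S, and N otherwise. Whether u gets examined depends only on S and
u, so membership in N can be tested when u arrives. An arriving member of N is
accepted if, for every B containing u, at most mu(B) members of N in B have
arrived, u included.

Value: f(M :|: O) + f(M), with O a shrinking part of the optimum T, is a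
submartingale, so 2 E f(M) >= f(T) + f(set0). Give u in N the weight a(u), its
marginal over the current M :|: N; these weights bound f from below on subsets
of N, and E a(N) = (E f(M :|: N) - f(set0)) / 40.

Loss: an element of N is rejected only if some B containing it has
#|N :&: B| > mu(B). Marginals over M only decrease, so the weight lost in B is
at most #|N :&: B| times the marginal of the first examined element of B. With
k = mu(B), #|N :&: B| is dominated by a negative binomial variable (failures
before the k-th success), so the expected loss is at most 5^-k / 20 times that
marginal. After discarding the sets having a larger set of no larger capacity,
the sets containing a given element have distinct capacities, and these factors
sum to at most 1/80.
*)

Set Implicit Arguments.
Unset Strict Implicit.
Unset Printing Implicit Defensive.

(** * Bernoulli random subsets *)

Definition head_prob : R := 39%:R / 40%:R.
Definition tail_prob : R := 1 / 40%:R.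

Section Bernoulli.
Variable U : finType.

Definition bern (A : {set U}) : R := \prod_x (if x \in A then head_prob else tail_prob).

Definition expect (h : {set U} -> R) : R := \sum_A bern A * h A.

Lemma head_tail_prob : head_prob + tail_prob = 1.
Proof. rewrite /head_prob /tail_prob; lra. Qed.
Lemma head_prob_ge0 : 0 <= head_prob. Proof. rewrite /head_prob; lra. Qed.
Lemma tail_prob_ge0 : 0 <= tail_prob. Proof. rewrite /tail_prob; lra. Qed.

Lemma bern_ge0 A : 0 <= bern A.
Proof.
by apply: prodr_ge0 => x _; case: ifP => _; [exact: head_prob_ge0 | exact: tail_prob_ge0].
Qed.

Lemma sum_bern : \sum_A bern A = 1.
Proof.
pose G (x : U) (b : bool) : R := if b then head_prob else tail_prob.
have: \prod_(x : U) \sum_(b : bool) G x b = 1.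
  by rewrite big1 // => x _; rewrite big_bool /= head_tail_prob.
rewrite bigA_distr_bigA => <-.
rewrite (reindex (fun A : {set U} => [ffun x => x \in A])) /=; last first.
  exists (fun g : {ffun U -> bool} => [set x | g x]) => [A _ | g _].
    by apply/setP => x; rewrite inE ffunE.
  by apply/ffunP => x; rewrite ffunE inE.
by apply: eq_bigr => A _; apply: eq_bigr => x _; rewrite ffunE.
Qed.

Lemma bern_imset (s : {perm U}) (A : {set U}) : bern (s @: A) = bern A.
Proof.
rewrite /bern (reindex_inj (@perm_inj _ s)) /=.
by apply: eq_bigr => x _; rewrite mem_imset //; exact: perm_inj.
Qed.

Lemma sum_set_split (u : U) (h : {set U} -> R) :
  \sum_A h A = \sum_(A : {set U} | u \notin A) (h (u |: A) + h A).
Proof.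
rewrite (bigID (fun A : {set U} => u \in A)) /= big_split /=; congr (_ + _).
rewrite (reindex_onto (fun A => u |: A) (fun A => A :\ u)) /=; last first.
  by move=> A uA; rewrite setD1K.
apply: eq_bigl => A; rewrite setU11 /=.
apply/eqP/idP => [<-|uA]; first by rewrite setD11.
by rewrite setU1K.
Qed.

(** Conditions on the coin of [u]. Both branches are again expectations over all sets, so the
    conditioning can be iterated. *)
Lemma expect_split (u : U) (h : {set U} -> R) :
  expect h = head_prob * expect (fun A => h (u |: A)) +
             tail_prob * expect (fun A => h (A :\ u)).
Proof.
rewrite /expect !(sum_set_split u) !mulr_sumr -big_split /=.
apply: eq_bigr => A uA.
set b := \prod_(x | x != u) (if x \in A then head_prob else tail_prob).
have b1 : bern (u |: A) = head_prob * b.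
  rewrite /bern (bigD1 u) //= setU11; congr (_ * _).
  by apply: eq_bigr => x xu; rewrite !inE (negPf xu).
have b2 : bern A = tail_prob * b by rewrite /bern (bigD1 u) //= (negPf uA).
have E1 : A :\ u = A by apply/setDidPl; rewrite disjoint_sym disjoints1.
rewrite b1 b2 setUA setUid setU1K // E1.
have := head_tail_prob; set p := head_prob; set q := tail_prob => pq.
have -> : q = 1 - p by rewrite -pq; ring.
ring.
Qed.

Lemma eq_expect h h' : h =1 h' -> expect h = expect h'.
Proof. by move=> e; apply: eq_bigr => A _; rewrite e. Qed.

Lemma expect_const c : expect (fun=> c) = c.
Proof. by rewrite /expect -mulr_suml sum_bern mul1r. Qed.

Lemma expectD h h' : expect (fun A => h A + h' A) = expect h + expect h'.
Proof. by rewrite /expect -big_split /=; apply: eq_bigr => A _; rewrite mulrDr. Qed.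

Lemma expectN h : expect (fun A => - h A) = - expect h.
Proof. by rewrite /expect -sumrN; apply: eq_bigr => A _; rewrite mulrN. Qed.

Lemma expect_sum (I : finType) (P : pred I) (h : I -> {set U} -> R) :
  expect (fun A => \sum_(i | P i) h i A) = \sum_(i | P i) expect (h i).
Proof.
by rewrite /expect exchange_big /=; apply: eq_bigr => A _; rewrite mulr_sumr.
Qed.

End Bernoulli.

(** * Exchange in laminar matroids and the greedy choice *)

Section Greedy.
Variables (U : finType) (F : {set {set U}}) (mu : {set U} -> nat).

Definition indep (T : {set U}) := [forall B in F, (#|T :&: B| <= mu B)%N].

Lemma indepP T : reflect (lam_indep F mu T) (indep T).
Proof. by apply: (iffP forall_inP). Qed.

Lemma indepS (S T : {set U}) : S \subset T -> indep T -> indep S.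
Proof.
move=> ST /forall_inP iT; apply/forall_inP => B BF.
by apply: leq_trans (iT _ BF); apply/subset_leq_card/setSI.
Qed.

(** Every set violated by [u |: M :|: O] contains [u], so by laminarity a smallest one, [B], lies in
    all the others. Each is overfull by one, and dropping a single element of [O] in [B] repairs
    them all. *)
Lemma indep_exchange (M O : {set U}) u : laminar F ->
  indep (M :|: O) -> indep (u |: M) -> [disjoint M & O] ->
  indep (u |: M :|: O) \/ exists2 o, o \in O & indep (u |: M :|: (O :\ o)).
Proof.
move=> lamF iMO iuM dMO.
have [i|] := boolP (indep (u |: M :|: O)); [by left | move=> ni; right].
pose viol B := (B \in F) && (mu B < #|(u |: M :|: O) :&: B|)%N.
have [B0 vB0] : exists B, viol B.
  move: ni; rewrite /indep negb_forall => /existsP[B].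
  by rewrite negb_imply -ltnNge => v; exists B.
case: (arg_minnP (fun B : {set U} => #|B|) vB0) => B /andP[BF vB] minB.
have uB C : C \in F -> (mu C < #|(u |: M :|: O) :&: C|)%N -> u \in C.
  move=> CF vC; apply/negPn/negP => uC.
  move/forall_inP: iMO => /(_ _ CF); rewrite leqNgt => /negP; apply.
  apply: leq_trans vC _; apply: subset_leq_card; apply/subsetP => x.
  rewrite !inE => /andP[/orP[/orP[/eqP ->|->]|->] xC]; rewrite ?xC ?orbT //.
  by rewrite xC in uC.
have [o oO oB] : exists2 o, o \in O & o \in B.
  have : ~~ ((u |: M :|: O) :&: B \subset (u |: M) :&: B).
    apply/negP => /subset_leq_card le.
    move/forall_inP: iuM => /(_ _ BF); rewrite leqNgt => /negP; apply.
    exact: leq_trans vB le.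
  case/subsetPn => o; rewrite inE => /andP[]; rewrite inE => /orP[oM oB|oO oB _].
    by rewrite inE oM oB.
  by exists o.
exists o => //; apply/forall_inP => C CF.
have [vC|] := ltnP (mu C) #|(u |: M :|: O) :&: C|; last first.
  apply: leq_trans; apply/subset_leq_card/setSI/setUS; exact: subsetDl.
have uC := uB C CF vC; have uBB := uB B BF vB.
have BC : B \subset C.
  case: (lamF B C BF CF) => [|[//|CB]].
    by move/pred0P/(_ u); rewrite /= uBB uC.
  have := minB C; rewrite /viol CF vC => /(_ isT) le.
  by have /eqP -> : C == B by rewrite eqEcard CB le.
have [ou|ou] := boolP (o \in u |: M).
  case/setU1P: ou => [e|oM].
    case/negP: ni; apply: indepS iMO; rewrite -e subUset subsetUr andbT.
    by rewrite subUset sub1set inE oO orbT subsetUl.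
  by move/pred0P/(_ o): dMO; rewrite /= oM oO.
have -> : (u |: M :|: O :\ o) :&: C = ((u |: M :|: O) :&: C) :\ o.
  apply/setP => x; rewrite !inE; case: (eqVneq x o) => [->|//] /=.
  by move: ou; rewrite !inE => /negPf ->.
rewrite -ltnS; apply: leq_trans (_ : #|(u |: M :|: O) :&: C| <= _)%N.
  rewrite [X in (_ <= X)%N](cardsD1 o) !inE oO orbT (subsetP BC _ oB) /=; by rewrite add1n.
have le : (#|(u |: M :|: O) :&: C| <= #|(M :|: O) :&: C|.+1)%N.
  apply: leq_trans (_ : #|u |: ((M :|: O) :&: C)| <= _)%N.
    apply: subset_leq_card; apply/subsetP => x; rewrite !inE.
    by case: (x == u) => //=.
  by rewrite cardsU1; case: (_ \notin _); rewrite ?add1n ?add0n // ltnW.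
apply: leq_trans le _; rewrite ltnS.
by move/forall_inP: iMO => /(_ _ CF).
Qed.

(** [pick] breaks ties by the enumeration order of [U], the same order for every [f], [M] and
    [Q]. *)
Definition greedy_choice (f : {set U} -> R) (M Q : {set U}) : option U :=
  [pick u | [&& u \in Q, indep (u |: M) &
    [forall v in Q, indep (v |: M) ==> (f (v |: M) <= f (u |: M))]]].

Variant greedy_choice_spec (f : {set U} -> R) (M Q : {set U}) : option U -> Type :=
| GreedySome u of u \in Q & indep (u |: M) &
    (forall v, v \in Q -> indep (v |: M) -> f (v |: M) <= f (u |: M)) :
    greedy_choice_spec f M Q (Some u)
| GreedyNone of (forall v, v \in Q -> ~~ indep (v |: M)) : greedy_choice_spec f M Q None.

Lemma greedy_choiceP f M Q : greedy_choice_spec f M Q (greedy_choice f M Q).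
Proof.
rewrite /greedy_choice; case: pickP => [u /and3P[uQ iu /forall_inP max] | no].
  by constructor=> // v vQ iv; move/implyP: (max v vQ); exact.
constructor=> v vQ; apply/negP => iv.
pose P := [pred x | (x \in Q) && indep (x |: M)].
have Pv : P v by rewrite /P /= vQ.
case: (Order.TotalTheory.arg_maxP (fun x => f (x |: M)) Pv) => u /andP[uQ iu] max.
have /negP := negbT (no u); apply; rewrite uQ iu /=.
by apply/forall_inP => x xQ; apply/implyP => ix; apply: max; rewrite /= xQ.
Qed.

Lemma greedy_choice_some f M Q u : greedy_choice f M Q = Some u ->
  [/\ u \in Q, indep (u |: M) &
  forall v, v \in Q -> indep (v |: M) -> f (v |: M) <= f (u |: M)].
Proof. by case: greedy_choiceP => // v vQ iv max [<-]. Qed.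

Lemma greedy_choice_none f M Q : greedy_choice f M Q = None ->
  forall v, v \in Q -> ~~ indep (v |: M).
Proof. by case: greedy_choiceP. Qed.

(** For simulation from the arrived elements [V]: if the chosen [u] is in [V], the maximisers over
    [Q :&: V] are maximisers over [Q], and [u], first among the latter, stays first. *)
Lemma greedy_choice_restrict (f f' : {set U} -> R) (M Q V : {set U}) : M \subset V ->
  (forall T : {set U}, T \subset V -> f' T = f T) ->
  (if greedy_choice f M Q is Some u then u \in V else true) ->
  greedy_choice f' M (Q :&: V) = greedy_choice f M Q.
Proof.
move=> MV ff'.
have ffu u : u \in V -> f' (u |: M) = f (u |: M).
  by move=> uV; apply: ff'; rewrite subUset sub1set uV.
have first (s : seq U) (P P' : pred U) u :
    ohead (filter (mem P) s) = Some u -> P' u ->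
    (forall x, P' x -> P x) -> ohead (filter (mem P') s) = Some u.
  move=> + P'u PP'; elim: s => //= x s IH; case: ifP => [Px [->]|Px /IH].
    by case: ifP => // nP; suff: false by []; rewrite -nP.
  by case: ifP => // /PP' Px'; suff: false by []; rewrite -Px.
case E: (greedy_choice f M Q) => [u|] => [uV | _]; last first.
  have no := greedy_choice_none E.
  by case: greedy_choiceP => // v; rewrite inE => /andP[vQ _] iv; have := no v vQ; rewrite iv.
have [uQ iu max] := greedy_choice_some E.
move: E; rewrite /greedy_choice /pick /enum_mem => /first; apply.
  rewrite inE uQ uV iu /=; apply/forall_inP => v; rewrite inE => /andP[vQ vV].
  by apply/implyP => iv; rewrite !ffu //; exact: max.
move=> x; rewrite inE => /and3P[/andP[xQ xV] ix /forall_inP mx].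
rewrite xQ ix /=; apply/forall_inP => v vQ; apply/implyP => iv.
apply: le_trans (max v vQ iv) _.
have := mx u; rewrite inE uQ uV => /(_ isT); rewrite iu /= !ffu //.
Qed.

End Greedy.

(** * The greedy process and expectations along it *)

Section Process.
Variables (U : finType) (F : {set {set U}}) (mu : {set U} -> nat).
Variable f : {set U} -> R.
Implicit Types (M N Q S O B : {set U}) (a : U -> R).

Local Notation indep := (indep F mu).
Local Notation greedy_choice := (greedy_choice F mu f).

Definition gain M u : R := f (u |: M) - f M.

Definition upd a u v : U -> R := fun x => if x == u then v else a x.

Definition state : Type := ({set U} * {set U} * (U -> R))%type.

(** A state consists of the greedy solution M, the set N of examined elements
outside the sample S, and the weights of N; Q is the set of unexamined elements
and n a bound on the number of steps. *)
Fixpoint run n M N a Q S : state :=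
  if n is n'.+1 then
    if greedy_choice M Q is Some u then
      if u \in S then run n' (u |: M) N a (Q :\ u) S
      else run n' M (u |: N) (upd a u (gain (M :|: N) u)) (Q :\ u) S
    else (M, N, a)
  else (M, N, a).

(** [mean g] is the expectation of [g] at the final state, and [cost c] that of
the sum of [c M u] over the examined elements [u]. *)
Fixpoint mean (g : {set U} -> {set U} -> (U -> R) -> R) n M N a Q : R :=
  if n is n'.+1 then
    if greedy_choice M Q is Some u then
      head_prob * mean g n' (u |: M) N a (Q :\ u) +
      tail_prob * mean g n' M (u |: N) (upd a u (gain (M :|: N) u)) (Q :\ u)
    else g M N a
  else g M N a.

Fixpoint cost (c : {set U} -> U -> R) n M Q : R :=
  if n is n'.+1 then
    if greedy_choice M Q is Some u then
      c M u + (head_prob * cost c n' (u |: M) (Q :\ u) + tail_prob * cost c n' M (Q :\ u))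
    else 0
  else 0.

(** The coin of an element is consulted only when it is examined, hence only while it is in [Q]. *)
Lemma run_indep n M N a Q S u : u \notin Q ->
  run n M N a Q (u |: S) = run n M N a Q S /\
  run n M N a Q (S :\ u) = run n M N a Q S.
Proof.
elim: n M N a Q => //= n IH M N a Q uQ; case: (greedy_choiceP F mu f M Q) => // v vQ _ _.
have vu : v != u by apply: contraNneq uQ => <-.
rewrite !inE (negPf vu) /=; case: ifP => _; apply: IH; by rewrite inE negb_and uQ orbT.
Qed.

(** Deferred decisions: each coin is read at most once, so it may be tossed at the moment of
    examination. *)
Lemma expect_run g n M N a Q :
  expect (fun S => let: (M', N', a') := run n M N a Q S in g M' N' a') = mean g n M N a Q.
Proof.
elim: n M N a Q => /= [|n IH] M N a Q; first exact: expect_const.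
case: (greedy_choiceP F mu f M Q) => [u uQ _ _|_]; last exact: expect_const.
rewrite (expect_split u) -!IH; congr (_ * _ + _ * _); apply: eq_expect => S.
  by rewrite setU11 (run_indep _ _ _ _ _ _).1 // setD11.
by rewrite setD11 (run_indep _ _ _ _ _ _).2 // setD11.
Qed.

Lemma mean_le g g' n M N a Q :
  (forall M N a, g M N a <= g' M N a) -> mean g n M N a Q <= mean g' n M N a Q.
Proof.
move=> le; elim: n M N a Q => //= n IH M N a Q; case: (greedy_choice M Q) => // u.
by rewrite lerD // ler_wpM2l ?head_prob_ge0 ?tail_prob_ge0.
Qed.

Lemma cost_ge0 c n M Q : (forall M u, 0 <= c M u) -> 0 <= cost c n M Q.
Proof.
move=> c0; elim: n M Q => //= n IH M Q; case: (greedy_choice M Q) => // u.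
by rewrite !addr_ge0 // mulr_ge0 ?head_prob_ge0 ?tail_prob_ge0.
Qed.

Lemma cost_le c c' n M Q :
  (forall M u, indep (u |: M) -> c M u <= c' M u) -> cost c n M Q <= cost c' n M Q.
Proof.
move=> le; elim: n M Q => //= n IH M Q; case: (greedy_choiceP F mu f M Q) => // u _ iu _.
by rewrite !lerD ?le // ler_wpM2l ?head_prob_ge0 ?tail_prob_ge0.
Qed.

Lemma costZ k c n M Q : cost (fun M u => k * c M u) n M Q = k * cost c n M Q.
Proof.
elim: n M Q => /= [|n IH] M Q; first by rewrite mulr0.
by case: (greedy_choice M Q) => [u|]; rewrite ?mulr0 // !IH; ring.
Qed.

Lemma cost_sum (I : finType) (P : pred I) (c : I -> {set U} -> U -> R) n M Q :
  cost (fun M u => \sum_(i | P i) c i M u) n M Q = \sum_(i | P i) cost (c i) n M Q.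
Proof.
elim: n M Q => /= [|n IH] M Q; first by rewrite big1.
case: (greedy_choice M Q) => [u|]; last by rewrite big1.
by rewrite !IH !mulr_sumr -!big_split.
Qed.

(** * Expected value of the greedy solution and of the weights *)

Hypotheses (f_mono : monotone_fun f) (f_sub : submodular f).

Lemma gain_ge0 M u : 0 <= gain M u.
Proof. by rewrite subr_ge0 f_mono // subsetUr. Qed.

Lemma gain_anti M N u : M \subset N -> gain N u <= gain M u.
Proof.
move=> MN; have [uN|uN] := boolP (u \in N).
  have -> : gain N u = 0 by rewrite /gain setUC (setUidPl _) ?sub1set // subrr.
  exact: gain_ge0.
have := f_sub (u |: M) N.
have -> : (u |: M) :|: N = u |: N by rewrite -setUA (setUidPr MN).
have -> : (u |: M) :&: N = M.
  rewrite setIUl (setIidPl MN) (_ : [set u] :&: N = set0) ?set0U //.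
  by apply/disjoint_setI0; rewrite disjoints1.
rewrite /gain; lra.
Qed.

(** Telescoping: an examined [u] raises [f M] by [gain M u] with probability [head_prob]. *)
Lemma cost_gain n M Q N a :
  head_prob * cost gain n M Q = mean (fun M _ _ => f M) n M N a Q - f M.
Proof.
elim: n M N a Q => /= [|n IH] M N a Q; first by rewrite mulr0 subrr.
case: (greedy_choice M Q) => [u|]; last by rewrite mulr0 subrr.
set N' := u |: N; set a' := upd _ _ _.
have /= E1 := IH (u |: M) N a (Q :\ u); have /= E2 := IH M N' a' (Q :\ u).
have -> : mean (fun M _ _ => f M) n (u |: M) N a (Q :\ u) =
  head_prob * cost gain n (u |: M) (Q :\ u) + f (u |: M) by rewrite E1 subrK.
have -> : mean (fun M _ _ => f M) n M N' a' (Q :\ u) =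
  head_prob * cost gain n M (Q :\ u) + f M by rewrite E2 subrK.
rewrite /gain; have -> : tail_prob = 1 - head_prob by rewrite -head_tail_prob; ring.
ring.
Qed.

(** An examined [u] joins [M :|: N] whichever way its coin falls, but its marginal is recorded as a
    weight only on tails. *)
Lemma mean_weight n M N a Q : [disjoint N & Q] ->
  mean (fun _ N a => \sum_(x in N) a x) n M N a Q - \sum_(x in N) a x =
  tail_prob * (mean (fun M N _ => f (M :|: N)) n M N a Q - f (M :|: N)).
Proof.
elim: n M N a Q => /= [|n IH] M N a Q dis; first by rewrite !subrr mulr0.
case: (greedy_choiceP F mu f M Q) => [u uQ _ _|]; last by rewrite !subrr mulr0.
have uN : u \notin N.
  by apply/negP => uN; move/pred0P/(_ u): dis; rewrite /= uN uQ.
set N' := u |: N; set a' := upd _ _ _.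
have d1 : [disjoint N & Q :\ u] by apply: disjointWr dis; exact: subsetDl.
have d2 : [disjoint N' & Q :\ u].
  rewrite -setI_eq0 setIUl (disjoint_setI0 d1) setU0 setI_eq0 disjoints1.
  by rewrite setD11.
have s' : \sum_(x in N') a' x = gain (M :|: N) u + \sum_(x in N) a x.
  rewrite big_setU1 //= /a' /upd eqxx; congr (_ + _).
  apply: eq_bigr => x xN; case: eqVneq => // xu; by rewrite -xu xN in uN.
have := IH (u |: M) N a (Q :\ u) d1; have := IH M N' a' (Q :\ u) d2.
rewrite s' -setUA (_ : M :|: N' = u |: (M :|: N)); last by rewrite setUCA.
move=> /(canRL (subrK _)) -> /(canRL (subrK _)) ->.
rewrite /gain; have -> : head_prob = 1 - tail_prob by rewrite -head_tail_prob; ring.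
ring.
Qed.

(** With [g = gain M u]: if [u] is in [O], heads raises the potential [f (M :|: O) + f M] by [g],
    and tails lowers it by at most [g]. Otherwise tails changes nothing, and on heads the exchanged
    element costs at most the [g] that [f M] gains. *)
Lemma greedy_half n M N a Q O : laminar F ->
  (#|Q| <= n)%N -> O \subset Q -> [disjoint M & Q] -> indep (M :|: O) ->
  f (M :|: O) + f M <= 2%:R * mean (fun M _ _ => f M) n M N a Q.
Proof.
move=> lamF.
(* At termination [O] is empty, since any element left in it could still be examined; the potential
   is then twice [f M]. *)
have base M' O' Q' : O' \subset Q' -> (forall v, v \in Q' -> ~~ indep (v |: M')) ->
    indep (M' :|: O') -> f (M' :|: O') + f M' <= 2%:R * f M'.
  move=> OQ no iMO; have -> : O' = set0.
    apply/setP => x; rewrite inE; apply/negbTE/negP => xO.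
    have := no x (subsetP OQ x xO); rewrite (indepS _ iMO) //.
    by rewrite subUset subsetUl andbT sub1set inE xO orbT.
  rewrite setU0; lra.
elim: n M N a Q O => [|n IH] M N a Q O.
  rewrite leqn0 cards_eq0 => /eqP -> O0 dis iMO; apply: (base _ _ _ O0) => //.
  by move=> v; rewrite inE.
move=> cQ OQ dis iMO /=; case: (greedy_choiceP F mu f M Q) => [u uQ iu max|]; last first.
  by move=> no; apply: (base _ _ _ OQ).
have uM : u \notin M by apply/negP => uM; move/pred0P/(_ u): dis; rewrite /= uM uQ.
have cQ' : (#|Q :\ u| <= n)%N by move: cQ; rewrite (cardsD1 u) uQ.
have dM : [disjoint M & Q :\ u] by apply: disjointWr dis; exact: subsetDl.
have duM : [disjoint u |: M & Q :\ u].
  rewrite -setI_eq0 setIUl (disjoint_setI0 dM) setU0 setI_eq0 disjoints1.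
  by rewrite setD11.
have dMO : [disjoint M & O] by apply: disjointWr dis.
have loss o : o \in O -> f (M :|: O) <= f (M :|: O :\ o) + gain M u.
  move=> oO; have oQ := subsetP OQ o oO.
  have go : gain M o <= gain M u.
    rewrite /gain lerD2r max //; apply: indepS iMO.
    by rewrite subUset subsetUl andbT sub1set inE oO orbT.
  have := @gain_anti M (M :|: O :\ o) o (subsetUl _ _).
  rewrite {1}/gain setUCA setD1K //; lra.
have fu : f (u |: M) = f M + gain M u by rewrite /gain; ring.
have g0 := gain_ge0 M u.
set E1 := mean _ n (u |: M) _ _ _; set E2 := mean _ n M _ _ _.
have [uO|uO] := boolP (u \in O).
  have H1 : f (M :|: O) + f (u |: M) <= 2%:R * E1.
    have -> : M :|: O = u |: M :|: O :\ u by rewrite -setUA setUCA setD1K.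
    apply: IH => //; first exact: setSD.
    by rewrite -setUA setUCA setD1K.
  have H2 : f (M :|: O :\ u) + f M <= 2%:R * E2.
    apply: IH => //; first exact: setSD.
    by apply: indepS iMO; apply: setUS; exact: subsetDl.
  have := loss u uO; rewrite /head_prob /tail_prob; lra.
have OQu : O \subset Q :\ u by rewrite subsetD1 OQ.
have H2 : f (M :|: O) + f M <= 2%:R * E2 by apply: IH.
suff H1 : f (M :|: O) + f M <= 2%:R * E1 by rewrite /head_prob /tail_prob; lra.
case: (indep_exchange lamF iMO iu dMO) => [iuMO | [o oO io]].
  apply: le_trans (IH _ _ _ _ O _ _ _ _) => //.
  by rewrite lerD // f_mono // ?setSU // subsetUr.
apply: le_trans (IH _ _ _ _ (O :\ o) _ _ _ _) => //; last first.
  by apply: subset_trans OQu; exact: subsetDl.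
have := loss o oO; have : f (M :|: O :\ o) <= f (u |: M :|: O :\ o).
  by rewrite f_mono // setSU // subsetUr.
lra.
Qed.

(** * Expected loss in a single laminar set *)

Definition overflow B N a : R :=
  if (mu B < #|N :&: B|)%N then \sum_(x in N :&: B) a x else 0.

(** With h and t elements of B already in M and N, this bounds the expectation of
the final [t * (k < t)]: 20^t 2^(k-h) is a supermartingale for the coin, and
[2^k * 20^(t-k-1) >= t] as soon as [k < t]. *)
Definition charge k h t : R :=
  2%:R ^+ k * 20%:R ^+ t * 2%:R ^+ (k - h) / 20%:R ^+ k.+1.

Lemma charge_ge0 k h t : 0 <= charge k h t.
Proof. by rewrite /charge !(mulr_ge0, invr_ge0, exprn_ge0). Qed.

Lemma charge_step k h t : (h < k)%N ->
  head_prob * charge k h.+1 t + tail_prob * charge k h t.+1 <= charge k h t.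
Proof.
move=> hk; have := charge_ge0 k h.+1 t.
(* With [X = charge k h.+1 t] the claim reads [39/40 X + 40/40 X <= 2 X]; [h < k] keeps the
   truncated [k - h] positive. *)
have -> : charge k h t = 2%:R * charge k h.+1 t.
  by rewrite /charge -subSS subSn // exprS; ring.
have -> : charge k h t.+1 = 40%:R * charge k h.+1 t.
  by rewrite /charge -subSS subSn // !exprS; ring.
rewrite /head_prob /tail_prob; lra.
Qed.

Lemma charge_mono k h t t' : (t <= t')%N -> charge k h t <= charge k h t'.
Proof.
move=> tt; rewrite /charge !ler_wpM2r ?invr_ge0 ?exprn_ge0 //.
by rewrite ler_wpM2l ?exprn_ge0 // ler_eXn2l // ltr1n.
Qed.

Lemma charge_final k h t : (k < t)%N -> t%:R <= charge k h t.
Proof.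
move=> kt; rewrite /charge; set X := 2%:R ^+ (k - h).
have X1 : 1 <= X by rewrite exprn_ege1 // ler1n.
have -> : 2%:R ^+ k * 20%:R ^+ t * X / 20%:R ^+ k.+1 = 2%:R ^+ k * 20%:R ^+ (t - k.+1) * X.
  by rewrite -{1}(subnK kt) exprD; field; rewrite expf_neq0 // pnatr_eq0.
(* Weakening 20 to 2 leaves [2 ^ (t - 1)], which is still at least [t]. *)
apply: le_trans (_ : 2%:R ^+ k * 2%:R ^+ (t - k.+1) * 1 <= _); last first.
  apply: ler_pM => //; first by rewrite mulr_ge0 ?exprn_ge0.
  by rewrite ler_wpM2l ?exprn_ge0 // lerXn2r ?nnegrE ?ler_nat.
rewrite mulr1 -exprD -natrX ler_nat.
have -> : (k + (t - k.+1))%N = t.-1.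
  by case: t kt => // t; rewrite ltnS => kt; rewrite subSS subnKC.
by case: t kt => // t _; exact: ltn_expl.
Qed.

(** As [M] grows, marginals decrease, so [th] bounds all later weights too. The overflow is then at
    most [th] times the final count in [B], and [charge] bounds the mean of that count above
    capacity. *)
Lemma mean_overflow_le B th n M N a Q : B \in F -> 0 <= th ->
  [disjoint M & Q] -> 
  (forall v, v \in Q -> indep (v |: M) -> gain M v <= th) ->
  (forall x, x \in N :&: B -> a x <= th) ->
  mean (fun _ N a => overflow B N a) n M N a Q <=
  th * charge (mu B) #|M :&: B| #|N :&: B|.
Proof.
move=> BF th0.
have base M' N' a' : (forall x, x \in N' :&: B -> a' x <= th) ->
    overflow B N' a' <= th * charge (mu B) #|M' :&: B| #|N' :&: B|.
  move=> ath; rewrite /overflow; case: ltnP => kt; last by rewrite mulr_ge0 ?charge_ge0.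
  apply: le_trans (_ : th * #|N' :&: B|%:R <= _); last first.
    by rewrite ler_wpM2l // charge_final.
  by rewrite mulr_natr -sumr_const; apply: ler_sum => x /ath.
elim: n M N a Q => /= [|n IH] M N a Q dis gth ath; first exact: base.
case: (greedy_choiceP F mu f M Q) => [u uQ iu max|_]; last exact: base.
have uM : u \notin M by apply/negP => uM; move/pred0P/(_ u): dis; rewrite /= uM uQ.
have dM : [disjoint M & Q :\ u] by apply: disjointWr dis; exact: subsetDl.
have duM : [disjoint u |: M & Q :\ u].
  rewrite -setI_eq0 setIUl (disjoint_setI0 dM) setU0 setI_eq0 disjoints1.
  by rewrite setD11.
set N' := u |: N; set a' := upd _ _ _.
have ath' x : x \in N' :&: B -> a' x <= th.
  rewrite !inE /a' /upd; case: eqVneq => [-> _|_ /= xNB].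
    by apply: le_trans (gth u uQ iu); apply: gain_anti; exact: subsetUl.
  by apply: ath; rewrite inE.
have H1 := IH (u |: M) N a (Q :\ u) duM _ ath.
have {}H1 : mean (fun _ N a => overflow B N a) n (u |: M) N a (Q :\ u) <=
    th * charge (mu B) #|(u |: M) :&: B| #|N :&: B|.
  apply: H1 => v /setD1P[_ vQ] iv; apply: le_trans (gth v vQ _).
    by apply: gain_anti; exact: subsetUr.
  by apply: indepS iv; rewrite setUS // subsetUr.
have H2 : mean (fun _ N a => overflow B N a) n M N' a' (Q :\ u) <=
    th * charge (mu B) #|M :&: B| #|N' :&: B|.
  by apply: IH => // v /setD1P[_ vQ]; exact: gth.
have p0 := head_prob_ge0; have q0 := tail_prob_ge0.
apply: le_trans (lerD (ler_wpM2l p0 H1) (ler_wpM2l q0 H2)) _.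
have [uB|uB] := boolP (u \in B).
  have c1 : #|(u |: M) :&: B| = #|M :&: B|.+1.
    by rewrite setIUl (setIidPl _) ?sub1set // cardsU1 inE (negPf uM) add1n.
  (* Feasibility of [u] is what makes [charge_step] applicable: coins in [B] are tossed only while
     [M] has room there. *)
  have hk : (#|M :&: B| < mu B)%N by rewrite -c1; exact: (elimT (indepP _ _ _) iu).
  have c2 : (#|N' :&: B| <= #|N :&: B|.+1)%N.
    rewrite setIUl (setIidPl _) ?sub1set // cardsU1.
    by case: (_ \notin _); rewrite ?add1n ?add0n // ltnW.
  rewrite c1 !(mulrCA _ th) -mulrDr ler_wpM2l //.
  apply: le_trans (charge_step _ hk).
  by rewrite lerD2l ler_wpM2l // charge_mono.
have E X : (u |: X) :&: B = X :&: B.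
  apply/setP => x; rewrite !inE; case: eqVneq => [->|//]; by rewrite (negPf uB) !andbF.
rewrite /N' !E -mulrDl head_tail_prob mul1r //.
Qed.

(** Nothing is lost before [B] is reached. The first examined element of [B] has the largest
    marginal, and its term in [cost] alone pays for the whole overflow. *)
Lemma mean_overflow_cost B n M N a Q : B \in F ->
  [disjoint M & Q] -> M :&: B = set0 -> N :&: B = set0 ->
  mean (fun _ N a => overflow B N a) n M N a Q <=
  charge (mu B) 0 0 * cost (fun M u => if u \in B then gain M u else 0) n M Q.
Proof.
move=> BF; elim: n M N a Q => [|n IH] M N a Q dis MB NB.
  by rewrite /= /overflow NB cards0 ltn0 mulr0.
have overflow0 : overflow B N a = 0 by rewrite /overflow NB cards0.
have cM : #|M :&: B| = 0%N by rewrite MB cards0.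
have cN : #|N :&: B| = 0%N by rewrite NB cards0.
case E: (greedy_choice M Q) => [u|]; last by rewrite /= E overflow0 mulr0.
have [uQ iu max] := greedy_choice_some E.
have [uB|uB] := boolP (u \in B).
  apply: le_trans (@mean_overflow_le B (gain M u) n.+1 M N a Q BF (gain_ge0 _ _) dis _ _) _.
  - by move=> v vQ iv; rewrite /gain lerD2r max.
  - by move=> x; rewrite NB inE.
  rewrite cM cN mulrC ler_wpM2l ?charge_ge0 //= E uB lerDl.
  have c0 : forall M u, 0 <= (if u \in B then gain M u else 0).
    by move=> M' x; case: ifP => // _; exact: gain_ge0.
  by rewrite addr_ge0 // mulr_ge0 ?head_prob_ge0 ?tail_prob_ge0 // cost_ge0.
have uM : u \notin M by apply/negP => uM; move/pred0P/(_ u): dis; rewrite /= uM uQ.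
have dM : [disjoint M & Q :\ u] by apply: disjointWr dis; exact: subsetDl.
have duM : [disjoint u |: M & Q :\ u].
  rewrite -setI_eq0 setIUl (disjoint_setI0 dM) setU0 setI_eq0 disjoints1.
  by rewrite setD11.
have E' X : X :&: B = set0 -> (u |: X) :&: B = set0.
  move=> XB; rewrite setIUl XB setU0; apply/disjoint_setI0.
  by rewrite disjoints1.
rewrite /= E (negPf uB) add0r mulrDr !(mulrCA (charge _ _ _)).
by apply: lerD; rewrite ler_wpM2l ?head_prob_ge0 ?tail_prob_ge0 // IH // E'.
Qed.

End Process.

(** * Online simulation and independence of the accepted set *)

Section Selection.
Variables (U : finType) (F : {set {set U}}) (mu : {set U} -> nat).
Implicit Types (f g : {set U} -> R) (M N Q S V B : {set U}) (a : U -> R).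

Local Notation indep := (indep F mu).
Local Notation greedy_choice := (greedy_choice F mu).
Local Notation run := (run F mu).

(** An examined element outside [V] is not in [S], so it enters [N] and leaves [M] alone. Skipping
    it does not alter later choices, which depend on [M] and [Q] but not on [N]. *)
Lemma run_restrict f g V S n n' M N a a' Q : M \subset V ->
  (forall T : {set U}, T \subset V -> g T = f T) -> Q :&: S \subset V ->
  (#|Q| <= n)%N -> (#|Q :&: V| <= n')%N ->
  (run g n' M (N :&: V) a' (Q :&: V) S).1.2 = (run f n M N a Q S).1.2 :&: V.
Proof.
move=> + fg; elim: n n' M N a a' Q => [|n IH] n' M N a a' Q MV QS.
  rewrite leqn0 cards_eq0 => /eqP -> _ /=; rewrite set0I; case: n' => //= n'.
  by case: (greedy_choiceP F mu g M set0) => // u; rewrite inE.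
move=> cQ cQV /=; case E: (greedy_choice f M Q) => [u|]; last first.
  case: n' cQV => //= n' _.
  by rewrite (@greedy_choice_restrict _ F mu f g) ?E.
have [uQ _ _] := greedy_choice_some E.
have cQ' : (#|Q :\ u| <= n)%N by move: cQ; rewrite (cardsD1 u) uQ.
have QS' : (Q :\ u) :&: S \subset V by apply: subset_trans QS; apply/setSI/subsetDl.
have [uV|uV] := boolP (u \in V).
  have uQV : u \in Q :&: V by rewrite inE uQ.
  have eQ : (Q :&: V) :\ u = (Q :\ u) :&: V by rewrite setIDAC.
  case: n' cQV => [|n'] cQV; first by move: cQV; rewrite (cardsD1 u) uQV.
  have cQV' : (#|(Q :\ u) :&: V| <= n')%N by move: cQV; rewrite (cardsD1 u) uQV eQ.
  rewrite /= (@greedy_choice_restrict _ F mu f g) ?E // eQ; case: ifP => _.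
    by apply: IH => //; rewrite subUset sub1set uV.
  have -> : u |: (N :&: V) = (u |: N) :&: V.
    by rewrite setIUl (setIidPl (_ : [set u] \subset V)) ?sub1set.
  exact: IH.
have uS : u \notin S.
  by apply: contra uV => uS; apply: (subsetP QS); rewrite inE uQ.
rewrite (negPf uS).
have e X : (u |: X) :&: V = X :&: V.
  apply/setP => x; rewrite !inE; case: eqVneq => [->|//]; by rewrite (negPf uV) !andbF.
have eQ : Q :&: V = (Q :\ u) :&: V by rewrite -(e (Q :\ u)) setD1K.
rewrite eQ -(e N); apply: IH => //; by rewrite -eQ.
Qed.

Definition selected f V S : {set U} := (run f #|U| set0 set0 (fun=> 0) V S).1.2.

Lemma selected_restrict f g V S : S \subset V ->
  (forall T : {set U}, T \subset V -> g T = f T) ->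
  selected g V S = selected f setT S :&: V.
Proof.
move=> SV fg; rewrite /selected.
rewrite -(@run_restrict f g V S #|U| #|U| set0 set0 _ (fun=> 0)) ?set0I ?setTI //.
- exact: sub0set.
- by rewrite cardsT.
- by rewrite max_card.
Qed.

Lemma selected_eq f g V S : S \subset V ->
  (forall T : {set U}, T \subset V -> g T = f T) ->
  selected g V S = selected f V S.
Proof. by move=> SV fg; rewrite !(@selected_restrict f _ V S). Qed.

Lemma run_notin f n M N a Q S x : (x \in N -> x \notin S) ->
  x \in (run f n M N a Q S).1.2 -> x \notin S.
Proof.
elim: n M N a Q => //= n IH M N a Q xN; case: (greedy_choice f M Q) => // u.
case: ifP => uS; first exact: IH.
by apply: IH => /setU1P[->|//]; rewrite uS.
Qed.

Lemma selected_notin f V S x : x \in selected f V S -> x \notin S.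
Proof. by apply: run_notin; rewrite inE. Qed.

(** The arrived part of [N], with the first [m] arrivals as sample. It is empty while at most [m]
    elements have arrived. *)
Definition passing m (s : seq U) f : {set U} :=
  selected f [set z in s] [set z in take m s].

Definition accept m : strategy U := fun s g =>
  if s is x :: s' then
    let y := last x s' in
    (y \in passing m s g) &&
    [forall B in F, (y \in B) ==> (#|passing m s g :&: B| <= mu B)%N]
  else false.

Lemma accept_rcons m s y g : accept m (rcons s y) g =
  (y \in passing m (rcons s y) g) &&
  [forall B in F, (y \in B) ==> (#|passing m (rcons s y) g :&: B| <= mu B)%N].
Proof. by case: s => //= x s; rewrite last_rcons. Qed.

Lemma accept_online m : online (accept m).
Proof.
move=> s g g' gg'; case: s gg' => // x s gg'; rewrite /accept.
suff -> : passing m (x :: s) g = passing m (x :: s) g' by [].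
apply: selected_eq => //; apply/subsetP => z; rewrite !inE => /mem_take.
by rewrite inE.
Qed.

(** Membership in [N] is settled on arrival and never revised, so the counts tested by [accept] only
    grow. *)
Lemma passing_prefix m s1 s2 f :
  passing m s1 f = passing m (s1 ++ s2) f :&: [set z in s1].
Proof.
have sub (s : seq U) : [set z in take m s] \subset [set z in s].
  by apply/subsetP => z; rewrite !inE => /mem_take.
rewrite /passing (selected_restrict (f := f) (sub s1)) //.
rewrite (selected_restrict (f := f) (sub (s1 ++ s2))) // -setIA.
have -> : [set z in s1 ++ s2] :&: [set z in s1] = [set z in s1].
  by apply/setIidPr/subsetP => z; rewrite !inE mem_cat => ->.
rewrite take_cat; case: ltnP => // lt.
(* Here all of [s1] is sampled. The two samples may differ, but neither run puts an element of [s1]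
   into [N]. *)
apply/setP => x; rewrite !inE.
have [xs|] := boolP (x \in s1); rewrite ?andbF // !andbT.
have n1 : x \in [set z in take m s1] by rewrite inE take_oversize.
have n2 : x \in [set z in s1 ++ take (m - size s1) s2] by rewrite inE mem_cat xs.
by apply/idP/idP => /selected_notin; rewrite ?n1 ?n2.
Qed.

Lemma passing_sub m s f : passing m s f \subset [set z in s].
Proof. by rewrite (passing_prefix m s [::]) subsetIr. Qed.

Lemma accepted_rec_rcons (d : strategy U) f pre r x :
  accepted_rec d f pre (rcons r x) =
  accepted_rec d f pre r ++ (if d (rcons (pre ++ r) x) f then [:: x] else [::]).
Proof.
elim: r pre => [|y r IH] pre /=; first by rewrite !cats0.
by rewrite IH cat_rcons catA.
Qed.

Lemma ALG_rcons (d : strategy U) f s x : ALG d f (rcons s x) =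
  if d (rcons s x) f then x |: ALG d f s else ALG d f s.
Proof.
apply/setP => y; rewrite /ALG accepted_rec_rcons /=.
by case: ifP => _; rewrite ?inE ?mem_cat ?inE ?orbF // orbC.
Qed.

Lemma passing_rcons m s x f : passing m s f \subset passing m (rcons s x) f.
Proof. by rewrite -cats1 (passing_prefix m s [:: x]) subsetIl. Qed.

Lemma ALG_passing m f s : ALG (accept m) f s \subset passing m s f.
Proof.
elim/last_ind: s => [|s x IH]; first by apply/subsetP => x; rewrite inE.
have IH' := subset_trans IH (passing_rcons m s x f).
rewrite ALG_rcons; case: ifP => //; rewrite accept_rcons => /andP[xp _].
by rewrite subUset sub1set xp.
Qed.

(** Only acceptances in [B] matter: at each of them everything accepted so far lies in the passing
    set, whose count in [B] has just been tested. *)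
Lemma ALG_indep m f s : lam_indep F mu (ALG (accept m) f s).
Proof.
elim/last_ind: s => [|s x IH] B BF.
  by rewrite (_ : ALG _ _ _ = set0) ?set0I ?cards0 //; apply/setP => x; rewrite !inE.
have sub := ALG_passing m f (rcons s x).
have := ALG_rcons (accept m) f s x.
case: ifP => [|_ -> //]; last exact: IH.
rewrite accept_rcons => /andP[xp /forall_inP ok] E.
have [xB|xB] := boolP (x \in B).
  by apply: leq_trans (implyP (ok B BF) xB); apply/subset_leq_card/setSI.
rewrite E setIUl (_ : [set x] :&: B = set0) ?set0U; first exact: IH.
by apply/disjoint_setI0; rewrite disjoints1.
Qed.

(** Elements sure to be accepted in whatever order [N] arrives, since the count tested on arrival is
    at most the final one. *)
Definition safe N := [set x in N | [forall B in F, (x \in B) ==> (#|N :&: B| <= mu B)%N]].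

Lemma safe_ALG m f s : safe (passing m s f) \subset ALG (accept m) f s.
Proof.
apply/subsetP => x; elim/last_ind: s => [|s y IH].
  by rewrite inE => /andP[/(subsetP (passing_sub _ _ _))]; rewrite inE.
rewrite inE => /andP[xp /forall_inP ok]; rewrite ALG_rcons.
have [xy|xy] := eqVneq x y.
  subst y; rewrite accept_rcons xp; case: ifP => [_|/negP[]]; first by rewrite setU11.
  exact/forall_inP.
have xs : x \in passing m s f.
  have -> := passing_prefix m s [:: y] f; rewrite cats1 inE xp inE /=.
  have := subsetP (passing_sub _ _ _) x xp.
  by rewrite inE mem_rcons inE (negPf xy).
suff xA : x \in ALG (accept m) f s by case: ifP => // _; rewrite inE xA orbT.
apply: IH; rewrite inE xs; apply/forall_inP => B BF; apply/implyP => xB.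
apply: leq_trans (implyP (ok B BF) xB).
by apply/subset_leq_card/setSI/passing_rcons.
Qed.

(** * Laminar sets that suffice to account for the losses *)

Definition critical : {set {set U}} :=
  [set B in F | [forall C in F, (B \proper C) ==> (mu B < mu C)%N]].

Lemma critical_sub B : B \in critical -> B \in F.
Proof. by rewrite inE => /andP[]. Qed.

(** [C] is a largest superset of [B] in [F] of no larger capacity; it is overfull whenever [B]
    is. *)
Lemma criticalP B : B \in F ->
  exists C, [/\ C \in critical, B \subset C & (mu C <= mu B)%N].
Proof.
move=> BF; pose P := [pred C : {set U} | [&& C \in F, B \subset C & (mu C <= mu B)%N]].
have PB : P B by rewrite /P /= BF subxx leqnn.
case: (arg_maxnP (fun C : {set U} => #|C|) PB) => C /and3P[CF BC mC] max.
exists C; split=> //; rewrite inE CF; apply/forall_inP => D DF; apply/implyP => CD.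
rewrite ltnNge; apply/negP => mD; have := max D; rewrite /P /= DF (leq_trans mD mC).
rewrite (subset_trans BC (proper_sub CD)) => /(_ isT).
by rewrite /= leqNgt (proper_card CD).
Qed.

(** The critical sets through [u] form a chain, along which capacities strictly increase. *)
Lemma critical_inj u : laminar F ->
  {in [pred B | (B \in critical) && (u \in B)] &, injective mu}.
Proof.
move=> lamF B C; rewrite !inE => /andP[/andP[BF /forall_inP cB] uB].
move=> /andP[/andP[CF /forall_inP cC] uC] e.
apply/eqP; rewrite eqEsubset.
case: (lamF B C BF CF) => [|[s|s]]; first by move/pred0P/(_ u); rewrite /= uB uC.
  rewrite s /=; apply: contraT => ns.
  by have := implyP (cB C CF); rewrite properE s ns e ltnn => /(_ isT).
rewrite s andbT; apply: contraT => ns.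
by have := implyP (cC B BF); rewrite properE s ns e ltnn => /(_ isT).
Qed.

(** * Value of the accepted set *)

Section Value.
Variable f : {set U} -> R.
Hypotheses (f_mono : monotone_fun f) (f_sub : submodular f).

(** The weight of [u] is its marginal over a set containing all earlier elements of [N], hence at
    most its marginal over the earlier part of any [X]. *)
Lemma run_weights n M N a Q S : [disjoint N & Q] ->
  (forall x, x \in N -> 0 <= a x) ->
  (forall X : {set U}, X \subset N -> f set0 + \sum_(x in X) a x <= f X) ->
  let: (M', N', a') := run f n M N a Q S in
  (forall x, x \in N' -> 0 <= a' x) /\
  (forall X : {set U}, X \subset N' -> f set0 + \sum_(x in X) a' x <= f X).
Proof.
elim: n M N a Q => //= n IH M N a Q dis a0 aX.
case: (greedy_choiceP F mu f M Q) => // u uQ _ _.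
have uN : u \notin N.
  by apply/negP => uN; move/pred0P/(_ u): dis; rewrite /= uN uQ.
have d1 : [disjoint N & Q :\ u] by apply: disjointWr dis; exact: subsetDl.
case: ifP => _; first exact: IH.
apply: IH.
- rewrite -setI_eq0 setIUl (disjoint_setI0 d1) setU0 setI_eq0 disjoints1.
  by rewrite setD11.
- move=> x; rewrite /upd; case: eqVneq => [_ _|xu]; first exact: gain_ge0.
  by rewrite !inE (negPf xu) => /a0.
set a' := upd _ _ _.
have a'E X : u \notin X -> \sum_(x in X) a' x = \sum_(x in X) a x.
  move=> uX; apply: eq_bigr => x xX; rewrite /a' /upd; case: eqVneq => // xu.
  by rewrite -xu xX in uX.
move=> X XN; have [uX|uX] := boolP (u \in X); last first.
  rewrite a'E //; apply: aX; apply/subsetP => x xX.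
  by have /setU1P[xu|//] := subsetP XN x xX; rewrite -xu xX in uX.
have XuN : X :\ u \subset N by rewrite subDset.
rewrite (big_setD1 u) //= a'E ?setD11 // {1}/a' /upd eqxx.
have := aX _ XuN.
have : gain f (M :|: N) u <= gain f (X :\ u) u.
  by apply: gain_anti => //; apply: subset_trans XuN _; exact: subsetUr.
rewrite {2}/gain setD1K //; lra.
Qed.

Definition lower_bound (N : {set U}) a : R :=
  f set0 + \sum_(x in N) a x - \sum_(B in critical) overflow mu B N a.

(** Union bound: each weight outside [safe N] is subtracted at least once, for some overfull
    critical set. *)
Lemma lower_bound_safe N a : (forall x, x \in N -> 0 <= a x) ->
  (forall X : {set U}, X \subset N -> f set0 + \sum_(x in X) a x <= f X) ->
  lower_bound N a <= f (safe N).
Proof.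
move=> a0 aX; have sN : safe N \subset N by apply/subsetP => x; rewrite inE => /andP[].
apply: le_trans (aX _ sN); rewrite /lower_bound -addrA lerD2l lerBlDr.
rewrite (big_setID (safe N)) /= (setIidPr sN) lerD2l.
have overflowE B : overflow mu B N a =
    \sum_(x in N) (if (x \in B) && (mu B < #|N :&: B|)%N then a x else 0).
  rewrite /overflow; case: ltnP => _; last by rewrite big1 // => x _; rewrite andbF.
  rewrite -big_mkcondr /=; apply: eq_bigl => x; by rewrite inE andbT.
under [leRHS]eq_bigr => B _ do rewrite overflowE.
rewrite exchange_big /= [leRHS](big_setID (safe N)) /= -[leLHS]add0r.
have pos x : x \in N ->
    0 <= \sum_(B in critical) (if (x \in B) && (mu B < #|N :&: B|)%N then a x else 0).
  by move=> xN; apply: sumr_ge0 => B _; case: ifP => // _; exact: a0.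
apply: lerD; first by apply: sumr_ge0 => x /setIP[xN _]; exact: pos.
apply: ler_sum => x; rewrite !inE => /andP[+ xN]; rewrite xN /= => /forall_inPn[B BF].
rewrite negb_imply -ltnNge => /andP[xB mB].
have [C [Cc BC mC]] := criticalP BF.
rewrite (bigD1 C) //= (subsetP BC x xB) /=.
have -> : (mu C < #|N :&: C|)%N.
  by apply: leq_ltn_trans mC _; apply: leq_trans mB _; apply/subset_leq_card/setIS.
rewrite lerDl; apply: sumr_ge0 => D _; case: ifP => // _; exact: a0.
Qed.

(** A function of the sample alone, free of the arrival order, so that its mean is given by
    [expect_run]. *)
Definition guarantee S : R :=
  let: (_, N, a) := run f #|U| set0 set0 (fun=> 0) setT S in lower_bound N a.

Lemma ALG_guarantee m s : (forall x, x \in s) ->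
  guarantee [set z in take m s] <= f (ALG (accept m) f s).
Proof.
move=> all; apply: le_trans (f_mono (safe_ALG m f s)).
have -> : passing m s f = selected f setT [set z in take m s].
  by rewrite /passing; congr selected; apply/setP => x; rewrite !inE all.
rewrite /guarantee /selected.
have := @run_weights #|U| set0 set0 (fun=> 0) setT [set z in take m s].
case: (run f _ _ _ _ _ _) => [[M N] a] /= H.
have [] // : (forall x, x \in N -> 0 <= a x) /\
  (forall X : {set U}, X \subset N -> f set0 + \sum_(x in X) a x <= f X).
  apply: H => [|x|X]; rewrite ?inE //.
    by rewrite -setI_eq0 set0I.
  by rewrite subset0 => /eqP ->; rewrite big_set0 addr0.
exact: lower_bound_safe.
Qed.

(** * Total loss and the competitive ratio *)

Lemma charge_init k : charge k 0 0 = 5%:R^-1 ^+ k / 20%:R.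
Proof.
have -> : 5%:R^-1 ^+ k = (2%:R * 2%:R) ^+ k * (20%:R ^+ k)^-1 :> R.
  by rewrite -exprVn -exprMn; congr (_ ^+ _); field.
by rewrite /charge subn0 expr0 mulr1 -exprMn exprS invfM mulrA mulrAC.
Qed.

(** [5/4] is [1 / (1 - 1/5)]. The window length [l] carries the induction, which raises the lower
    end [m]. *)
Lemma geometric_sum (s : seq nat) m l : uniq s ->
  (forall j, j \in s -> (m <= j < m + l)%N) ->
  \sum_(j <- s) 5%:R^-1 ^+ j <= 5%:R / 4%:R * 5%:R^-1 ^+ m :> R.
Proof.
elim: l m s => [|l IH] m s us ms.
  case: s us ms => [|j s] _ ms; last first.
    by have := ms j (mem_head _ _); rewrite addn0 leqNgt andNb.
  by rewrite big_nil !(mulr_ge0, exprn_ge0, invr_ge0).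
have x0 : 0 <= 5%:R^-1 ^+ m :> R by rewrite exprn_ge0 // invr_ge0.
have [min|min] := boolP (m \in s).
  rewrite (big_rem m) //=.
  have := IH m.+1 (rem m s) (rem_uniq _ us) _; rewrite exprS.
  set t := \sum_(j <- _) _; set x := 5%:R^-1 ^+ m in x0 *.
  suff H : forall j, j \in rem m s -> (m < j < m.+1 + l)%N by move=> /(_ H); lra.
  move=> j; rewrite mem_rem_uniq // !inE => /andP[jm /ms].
  by case/andP=> mj jl; rewrite addSnnS jl andbT ltn_neqAle eq_sym jm.
apply: le_trans (IH m.+1 s us _) _; last by rewrite exprS; lra.
move=> j js; have /andP[mj jl] := ms j js.
by rewrite addSnnS jl andbT ltn_neqAle mj andbT; apply: contraNneq min => ->.
Qed.

Lemma critical_charge u : laminar F -> indep [set u] ->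
  \sum_(B in critical | u \in B) charge (mu B) 0 0 <= 80%:R^-1.
Proof.
move=> lamF iu; under eq_bigr => B _ do rewrite charge_init.
rewrite -mulr_suml.
set P := [pred B : {set U} | (B \in critical) && (u \in B)].
have -> : \sum_(B in critical | u \in B) 5%:R^-1 ^+ mu B =
    \sum_(j <- map mu (enum P)) 5%:R^-1 ^+ j :> R.
  by rewrite big_map big_enum.
suff : \sum_(j <- map mu (enum P)) 5%:R^-1 ^+ j <= 5%:R / 4%:R * 5%:R^-1 ^+ 1 :> R.
  by lra.
(* Exponents start at 1, as independence of [[set u]] forces [mu B >= 1]; the total is
   [5/4 * 1/5 * 1/20 = 1/80]. *)
apply: (@geometric_sum _ 1 (\max_(j <- map mu (enum P)) j)).
  rewrite map_inj_in_uniq ?enum_uniq // => B C; rewrite !mem_enum.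
  exact: critical_inj.
move=> j jP; rewrite add1n ltnS; apply/andP; split; last exact: leq_bigmax_seq.
case/mapP: jP => B; rewrite mem_enum inE => /andP[/critical_sub BF uB] ->.
have := elimT (indepP _ _ _) iu B BF.
by rewrite (setIidPl _) ?sub1set // cards1.
Qed.

Lemma expect_guarantee T : laminar F -> nonneg_fun f -> lam_indep F mu T ->
  f T / 211%:R <= expect guarantee.
Proof.
move=> lamF f0 /indepP iT.
pose mean0 e := mean F mu f e #|U| set0 set0 (fun=> 0) setT.
pose c := cost F mu f (gain f) #|U| set0 setT.
have disT : [disjoint (set0 : {set U}) & [set: U]] by rewrite -setI_eq0 set0I.
have -> : expect guarantee = f set0 + mean0 (fun _ N a => \sum_(x in N) a x) -
    \sum_(B in critical) mean0 (fun _ N a => overflow mu B N a).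
  rewrite -(expect_const U (f set0)) /mean0 -expect_run.
  under [in RHS]eq_bigr => B _ do rewrite -expect_run.
  rewrite -expect_sum -expectN -!expectD; apply: eq_expect => S; rewrite /guarantee.
  by case: (run f _ _ _ _ _ _) => [[M N] a].
have H1 : f T + f set0 <= 2%:R * mean0 (fun M _ _ => f M).
  have := @greedy_half U F mu f f_mono f_sub #|U| set0 set0 (fun=> 0) setT T lamF.
  rewrite set0U; apply=> //; first by rewrite cardsT.
have H2 := @mean_weight U F mu f #|U| set0 set0 (fun=> 0) setT disT.
rewrite big_set0 subr0 setU0 -/(mean0 _) -/(mean0 _) in H2.
have H3 : mean0 (fun M _ _ => f M) <= mean0 (fun M N _ => f (M :|: N)).
  by apply: mean_le => M N _; rewrite f_mono // subsetUl.
have H4 := @cost_gain U F mu f #|U| set0 setT set0 (fun=> 0).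
rewrite -/(mean0 _) -/c in H4.
have H5 : \sum_(B in critical) mean0 (fun _ N a => overflow mu B N a) <= 80%:R^-1 * c.
  apply: le_trans (_ : \sum_(B in critical) charge (mu B) 0 0 *
      cost F mu f (fun M u => if u \in B then gain f M u else 0) #|U| set0 setT <= _).
    apply: ler_sum => B /critical_sub BF.
    by apply: mean_overflow_cost => //; rewrite set0I.
  under eq_bigr => B _ do rewrite -costZ.
  (* With the sums exchanged, each examined [u] is charged once for every critical set containing
     it. *)
  rewrite -cost_sum -costZ; apply: cost_le => M u iu.
  apply: le_trans (_ : (\sum_(B in critical | u \in B) charge (mu B) 0 0) * gain f M u <= _).
    rewrite mulr_suml big_mkcondr /=; apply: ler_sum => B _.
    by case: ifP => _; rewrite ?mulr0.
  rewrite ler_wpM2r ?gain_ge0 // critical_charge //.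
  by apply: indepS iu; rewrite subsetUl.
have := f0 set0; have : f set0 <= f T by rewrite f_mono // sub0set.
move: H1 H2 H3 H4 H5.
(* Let [D = E1 - f set0], at least half of [f T - f set0]. The weights yield at least [D / 40], and
   the loss is at most [40/39 * D / 80 = D / 78]. The net factor is [(1/40 - 1/78) / 2 = 19/3120],
   above [1/211]. *)
set E1 := mean0 _; set E2 := mean0 _; set E3 := mean0 _; set X := \sum_(B in _) _.
rewrite /head_prob /tail_prob; lra.
Qed.

End Value.
End Selection.

(** Drawing the length of the rejected prefix as the size of a Bernoulli set A
makes the prefix itself Bernoulli distributed, by invariance under
permutations. *)
Lemma perm_to_front (U : finType) (A : {set U}) :
  exists s : {perm U}, [set z in take #|A| (arrival s)] = A.
Proof.
pose t := enum A ++ enum (~: A).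
have ut : uniq t.
  rewrite cat_uniq !enum_uniq andbT /=; apply/hasPn => x.
  by rewrite !mem_enum inE.
have st : size t = #|U| by rewrite size_cat -!cardE cardsC.
have ix x : (index x (enum U) < size t)%N by rewrite st cardE index_mem mem_enum.
have inj : injective (fun u => nth u t (index u (enum U))).
  move=> x y /eqP; rewrite (set_nth_default y) ?ix // nth_uniq ?ix // => /eqP e.
  by have := congr1 (nth x (enum U)) e; rewrite !nth_index ?mem_enum.
exists (perm inj).
have -> : arrival (perm inj) = t.
  case: (pickP U) => [x0 _|no]; last first.
    have nil (r : seq U) : r = [::] by case: r => // x; have := no x.
    by rewrite [LHS]nil [RHS]nil.
  apply: (@eq_from_nth _ x0); rewrite size_map -cardE ?st // => i lt.
  rewrite (nth_map x0) -?cardE // permE index_uniq ?enum_uniq -?cardE //.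
  by rewrite (set_nth_default x0) ?st.
rewrite take_cat -cardE ltnn subnn take0 cats0.
by apply/setP => x; rewrite inE mem_enum.
Qed.

Lemma sum_sample (U : finType) (A : {set U}) (h : {set U} -> R) :
  \sum_(s : {perm U}) h [set z in take #|A| (arrival s)] =
  \sum_(s : {perm U}) h (s @: A).
Proof.
have [s0 s0A] := perm_to_front A.
(* As [s0] brings [A] to the front, the prefix for [s0 * s] is the image of [A] under [s]. *)
rewrite (reindex_inj (mulgI s0)) /=; apply: eq_bigr => s _; congr h.
have -> : arrival (s0 * s)%g = map s (arrival s0).
  by rewrite /arrival -map_comp; apply: eq_map => x; rewrite permM.
rewrite -map_take -[in RHS]s0A; apply/setP => x; rewrite inE.
apply/mapP/imsetP => [[y yt ->]|[y yt ->]]; exists y => //; move: yt; by rewrite inE.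
Qed.

Theorem theorem1 :
  exists alg : rand_alg,
    forall (U : finType) (F : {set {set U}}) (mu : {set U} -> nat),
      laminar F ->
      valid_distr (alg U F mu) /\
      forall f : {set U} -> R,
        nonneg_fun f -> monotone_fun f -> submodular f ->
        (forall p q, List.In p (alg U F mu) ->
           lam_indep F mu (ALG p.2 f (arrival q))) /\
        (forall T : {set U}, lam_indep F mu T ->
           f T / 211%:R <= expected_value (alg U F mu) f).
Proof.
exists (fun U F mu => [seq (bern A, accept F mu #|A|) | A <- enum {set U}]).
move=> U F mu lamF; split.
  split=> [p /List.in_map_iff [A [<- _]]|].
    by split; [exact: bern_ge0 | exact: accept_online].
  by rewrite big_map big_enum /= sum_bern.
move=> f f0 f_mono f_sub; split=> [p q /List.in_map_iff [A [<- _]]|T iT].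
  exact: ALG_indep.
apply: le_trans (expect_guarantee f_mono f_sub lamF f0 iT) _.
rewrite /expected_value big_map big_enum /=.
apply: le_trans (_ : \sum_(A : {set U}) bern A * ((#|U|`!)%:R^-1 *
    \sum_(s : {perm U}) guarantee F mu f [set z in take #|A| (arrival s)]) <= _); last first.
  apply: ler_sum => A _; rewrite ler_wpM2l ?bern_ge0 // ler_wpM2l ?invr_ge0 //.
  apply: ler_sum => s _; apply: ALG_guarantee => // x.
  by apply/mapP; exists ((s^-1)%g x); rewrite ?mem_enum ?permKV.
(* For fixed [A] the average over orders turns the prefix into [s @: A]; after exchanging sums, [s]
   is fixed and [s @: A] is Bernoulli. *)
under eq_bigr => A _ do rewrite sum_sample mulrCA mulr_sumr.
rewrite -mulr_sumr exchange_big /=.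
have E (s : {perm U}) : \sum_(A : {set U}) bern A * guarantee F mu f (s @: A) =
    expect (guarantee F mu f).
  rewrite /expect [RHS](reindex_inj (imset_inj (@perm_inj _ s))) /=.
  by apply: eq_bigr => A _; rewrite bern_imset.
under eq_bigr => s _ do rewrite E.
rewrite sumr_const.
have -> : #|{: {perm U}}| = (#|U|`!)%N.
  rewrite -cardsT -card_perm; apply: eq_card => s.
  by rewrite !inE; apply/esym/subsetP => x _; rewrite inE.
by rewrite -[X in _ * X]mulr_natl mulKf // pnatr_eq0 -lt0n fact_gt0.
Qed.
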